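(* Let $q$ be an odd prime power and let $A,B\in\widehat{\mathbb{F}_q^*}$ with $A^2\neq\varepsilon$ and $B^4 \neq \varepsilon$. Then $${}_{4}F_{4}\left( \begin{array}{cccc} A, & \varphi A, & B, & \varphi B\\ \varepsilon, & \varphi, & A\overline{B}, & \varphi A\overline{B} \end{array} \Big| \; 1 \right)_{q} = \frac{g(B^2)\,g(\overline{A}^2 B^4)}{g(\overline{A}^2 B^2)\,g(B^4)} + \sum_{R^2=A^2} \frac{g(\overline{A}^2)\,g(\overline{R} B^2)}{g(\overline{R})\,g(\overline{A}^2 B^2)},$$ where the sum is over all $R\in\widehat{\mathbb{F}_q^*}$ with $R^2=A^2$.
   Context: $\mathbb{F}_q$ is the finite field with $q$ elements and $\widehat{\mathbb{F}_q^*}$ the group of (complex) multiplicative characters of $\mathbb{F}_q^*$; every $\chi\in\widehat{\mathbb{F}_q^*}$, including the trivial character $\varepsilon$, is extended to $\mathbb{F}_q$ by $\chi(0):=0$; $\overline{\chi}$ is the inverse of $\chi$; $\varphi$ is the character of order two. Fix a non-trivial additive character $\theta$ of $\mathbb{F}_q$ and define the Gauss sum $g(\chi):=\sum_{x\in\mathbb{F}_q}\chi(x)\theta(x)$. For $A_i,B_i\in\widehat{\mathbb{F}_q^*}$ and $\lambda\in\mathbb{F}_q$, $${}_{m}F_{m}\left( \begin{array}{ccc} A_1, & \dots, & A_m \\ B_1, & \dots, & B_m \end{array} \Big| \; \lambda \right)_{q} := \frac{-1}{q-1} \sum_{\chi \in \widehat{\mathbb{F}_q^{*}}} \prod_{i=1}^{m}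 \frac{g(A_i \chi)}{g(A_i)} \frac{g(\overline{B_i \chi})}{g(\overline{B_i})}\, \chi(-1)^{m} \chi(\lambda).$$ *)

(* Defs.v *)
From HB Require Import structures.
From mathcomp Require Import all_boot all_order all_fingroup all_algebra.
From mathcomp Require Import all_solvable all_field all_character.

Set Implicit Arguments.
Unset Strict Implicit.
Unset Printing Implicit Defensive.

Import Order.TTheory GRing.Theory Num.Theory.
Local Open Scope ring_scope.

(* Characters of finite groups take values in roots of unity, hence in algC:
   the multiplicative characters of F are the linear characters of the group
   of units {unit F}, and the additive ones those of F seen as an additive
   group. *)

Notation unitg F := [set: {unit F}]%G.

Section Hypergeometric.

Variable F : finFieldType.
Implicit Types (chi A B : 'CF(unitg F)) (theta : 'CF([set: F]%G)).

(* Sums over all multiplicative characters are sums over irr (unitg F): since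
   {unit F} is abelian, irr (unitg F) lists every linear character once. *)
Lemma mem_irr_unitg chi : (chi \in irr (unitg F)) = (chi \is a linear_char).
Proof.
apply/irrP/idP => [[i ->] | /lin_char_irr/irrP //].
apply/(char_abelianP _ _) => //.
by apply/centsP => x _ y _; apply: val_inj; rewrite /= mulrC.
Qed.

Lemma uniq_irr_unitg : uniq (irr (unitg F)).
Proof. exact: free_uniq (irr_free _). Qed.

Definition mchar chi (x : F) : algC := oapp chi 0 (insub x).

Lemma mchar_unit chi (u : {unit F}) : mchar chi (val u) = chi u.
Proof. by rewrite /mchar valK. Qed.

Lemma mchar0 chi : mchar chi 0 = 0.
Proof. by rewrite /mchar insubN // unitr0. Qed.

Definition gauss theta chi : algC := \sum_(x : F) mchar chi x * theta x.

(* The inverse in the ring 'CF(unitg F) is the pointwise one, which on a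
   linear character is the inverse character. *)
Definition hyperF theta m (A B : m.-tuple 'CF(unitg F)) (lambda : F) : algC :=
  (-1) / (#|F|%:R - 1) *
  \sum_(chi <- irr (unitg F))
    (\prod_(i < m)
       (gauss theta (tnth A i * chi) / gauss theta (tnth A i)
        * (gauss theta (tnth B i * chi)^-1 / gauss theta (tnth B i)^-1)))
    * mchar chi (-1) ^+ m * mchar chi lambda.

End Hypergeometric.

(* Main.v *)
(** With a = A^2, b = B^2 and psi = chi^2, the Hasse-Davenport relation
    chi(4) g(chi) g(phi chi) = g(chi^2) g(phi) turns the summand of the 4F4 into
    a constant times g(a psi) g(b psi) g(psi^-1) g((a b^-1 psi)^-1).  Pairing the
    Gauss sums so that both products of characters equal b gives
    g(b)^2 J(b psi, psi^-1) J(a psi, (a b^-1 psi)^-1), and x/(1 - x) as variable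
    makes each Jacobi sum a Mellin transform of c(x) b^-1(1 + x), c = b or a.
    Summing psi(x y) = chi((x y)^2) over chi leaves the points x y = 1 and
    x y = -1.  The first gives J(a, a^-1 b^2) (the Gauss-type term); the second
    gives the Kummer-type sum of A(y^2) b^-1(1 - y^2), which is
    J(A, b^-1) + J(phi A, b^-1). *)

Require Import Defs.
From HB Require Import structures.
From mathcomp Require Import all_boot all_order all_fingroup all_algebra.
From mathcomp Require Import all_solvable all_field all_character.
From mathcomp Require Import ring.

Set Implicit Arguments.
Unset Strict Implicit.
Unset Printing Implicit Defensive.

Import Order.TTheory GRing.Theory Num.Theory.
Local Open Scope ring_scope.

(** * Multiplicative characters extended by zero, and their orthogonality *)

Section MultiplicativeCharacters.

Variable F : finFieldType.
Implicit Types (chi psi : 'CF(unitg F)) (x y : F).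

Lemma unit_of_neq0 x : x != 0 -> {u : {unit F} | x = val u}.
Proof. by rewrite -unitfE => ux; exists (Sub x ux). Qed.

Lemma mchar1_cfun x : mchar (1 : 'CF(unitg F)) x = (x != 0)%:R.
Proof.
have [->|/unit_of_neq0[u ->]] := eqVneq x 0; first exact: mchar0.
by rewrite mchar_unit cfun1E inE.
Qed.

Lemma mcharMc chi psi x : mchar (chi * psi) x = mchar chi x * mchar psi x.
Proof.
have [->|/unit_of_neq0[u ->]] := eqVneq x 0; first by rewrite !mchar0 mulr0.
by rewrite !mchar_unit cfunE.
Qed.

Lemma mcharM chi x y :
  chi \is a linear_char -> mchar chi (x * y) = mchar chi x * mchar chi y.
Proof.
move=> chiL; have [->|/unit_of_neq0[u ->]] := eqVneq x 0;
  first by rewrite mul0r !mchar0 mul0r.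
have [->|/unit_of_neq0[v ->]] := eqVneq y 0; first by rewrite mulr0 !mchar0 mulr0.
by rewrite -FinRing.val_unitM !mchar_unit lin_charM ?inE.
Qed.

Lemma mchar1 chi : chi \is a linear_char -> mchar chi 1 = 1.
Proof. by move=> chiL; rewrite -(FinRing.val_unit1 F) mchar_unit lin_char1. Qed.

Lemma mchar_neq0 chi x : chi \is a linear_char -> x != 0 -> mchar chi x != 0.
Proof. by move=> chiL /unit_of_neq0[u ->]; rewrite mchar_unit lin_char_neq0 ?inE. Qed.

Lemma mcharV chi x : chi \is a linear_char -> mchar chi x^-1 = (mchar chi x)^-1.
Proof.
move=> chiL; have [->|x0] := eqVneq x 0; first by rewrite invr0 mchar0 invr0.
apply: (mulfI (mchar_neq0 chiL x0)).
by rewrite -mcharM // !mulfV ?mchar_neq0 ?mchar1.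
Qed.

Lemma mcharX chi x n :
  chi \is a linear_char -> mchar chi (x ^+ n) = mchar chi x ^+ n.
Proof.
by move=> chiL; elim: n => [|n IHn]; rewrite ?mchar1 // !exprS mcharM // IHn.
Qed.

Lemma mcharVc chi x : chi \is a linear_char -> mchar chi^-1 x = mchar chi x^-1.
Proof.
move=> chiL; have [->|x0] := eqVneq x 0; first by rewrite invr0 !mchar0.
apply: (mulfI (mchar_neq0 chiL x0)).
rewrite -mcharMc mulrV ?lin_char_unitr // -mcharM // mulfV // mchar1 //.
by rewrite mchar1_cfun x0.
Qed.

(** The exponent is kept positive: at [x = 0] the trivial character [chi ^+ 0] gives [0], whereas
    [0 ^+ 0 = 1]. *)
Lemma mcharXc chi x n : mchar (chi ^+ n.+1) x = mchar chi x ^+ n.+1.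
Proof. by elim: n => // n IHn; rewrite exprS mcharMc IHn -exprS. Qed.

Lemma mcharN chi x :
  chi \is a linear_char -> mchar chi (- x) = mchar chi (-1) * mchar chi x.
Proof. by move=> chiL; rewrite -mcharM // mulN1r. Qed.

Lemma mcharN1_sqr chi : chi \is a linear_char -> mchar chi (-1) ^+ 2 = 1.
Proof. by move=> chiL; rewrite -mcharX // sqrrN expr1n mchar1. Qed.

Lemma mcharV_N1 chi : chi \is a linear_char -> mchar chi^-1 (-1) = mchar chi (-1).
Proof. by move=> chiL; rewrite mcharVc // invrN1. Qed.

(** Scaling the variable by a unit [u] with [chi u != 1] permutes the terms but multiplies the sum
    by [chi u]. *)
Lemma sum_mchar chi :
  chi \is a linear_char -> chi != 1 -> \sum_(x : F) mchar chi x = 0.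
Proof.
move=> chiL /eqP chi1.
have [u chiu] : exists u : {unit F}, chi u != 1.
  apply/existsP; apply: contra_notT chi1 => /existsPn chi_u; apply/cfunP => u.
  by rewrite cfun1E inE; apply/eqP; rewrite -[_ == _]negbK chi_u.
have u0 : (val u) != 0 by rewrite -unitfE (valP u).
apply/eqP; move: chiu; apply: contraNT => S0; apply/eqP/(mulIf S0).
rewrite mul1r mulr_sumr [RHS](reindex_inj (mulfI u0)) /=.
by apply: eq_bigr => x _; rewrite mcharM // mchar_unit.
Qed.

Lemma card_unitg : #|unitg F|%:R = #|F|%:R - 1 :> algC.
Proof.
rewrite card_finField_unit -subn1 natrB //.
by apply/card_gt0P; exists 0.
Qed.

Lemma card_field_sub1_neq0 : #|F|%:R - 1 != 0 :> algC.
Proof. by rewrite -card_unitg pnatr_eq0 -lt0n cardG_gt0. Qed.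

Lemma sum_mchar1 : \sum_(x : F) mchar (1 : 'CF(unitg F)) x = #|F|%:R - 1.
Proof.
rewrite (eq_bigr _ (fun x _ => mchar1_cfun x)) -natr_sum -card_unitg.
rewrite card_finField_unit -(cardC1 (0 : F)) -sum1_card [in RHS]big_mkcond /=.
by congr (_%:R); apply: eq_bigr => x _; rewrite inE; case: (x != 0).
Qed.

(** On units this is the value of the regular character, in which each linear character occurs
    once. *)
Lemma sum_irr_mchar x :
  \sum_(chi <- irr (unitg F)) mchar chi x = (#|F|%:R - 1) * (x == 1)%:R.
Proof.
have [->|/unit_of_neq0[u ->]] := eqVneq x 0.
  rewrite big1 => [|chi _]; last exact: mchar0.
  by rewrite eq_sym oner_eq0 mulr0.
rewrite -card_unitg mulr_natr -(FinRing.val_unit1 F) val_eqE.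
rewrite -cfRegE cfReg_sum sum_cfunE big_tuple; apply: eq_bigr => i _.
have chiL: 'chi_i \is a linear_char by rewrite -mem_irr_unitg mem_irr.
by rewrite cfunE lin_char1 // mul1r mchar_unit.
Qed.

End MultiplicativeCharacters.

(** * Jacobi sums, Gauss sums and the relations between them *)

Section GaussJacobi.

Variable F : finFieldType.
Implicit Types (chi psi : 'CF(unitg F)) (x y : F).

Definition jacobi chi psi : algC := \sum_(x : F) mchar chi x * mchar psi (1 - x).

(** The summand is [chi (x / (1 - x))], and [x / (1 - x)] takes every value except [-1]; so the sum
    is the full character sum, which vanishes, minus one term. *)
Lemma jacobiV chi :
  chi \is a linear_char -> chi != 1 -> jacobi chi chi^-1 = - mchar chi (-1).
Proof.
move=> chiL chi1; apply/eqP; rewrite -addr_eq0; apply/eqP.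
rewrite -[RHS](sum_mchar chiL chi1) [RHS](bigD1 (-1)) //= [LHS]addrC; congr (_ + _).
pose h (x : F) := x / (1 - x); pose k (y : F) := y / (1 + y).
rewrite /jacobi (bigD1 1) //= subrr mchar0 mulr0 add0r.
rewrite [RHS](reindex_onto h k) /= => [|y yN1]; last first.
  have y1: 1 + y != 0 by rewrite addrC -[1]opprK subr_eq0.
  rewrite /h /k; field; rewrite y1 /=.
  by rewrite addrK oner_neq0.
apply: eq_big => [x|x _]; last by rewrite mcharVc // -mcharM.
have [->|x1] := eqVneq x 1.
  by rewrite /h /k subrr invr0 mulr0 mul0r [0 == 1]eq_sym oner_eq0 andbF.
have d1 : 1 - x != 0 by rewrite subr_eq0 eq_sym.
have -> : h x == -1 = false.
  by apply/negbTE; rewrite -subr_eq0 opprK /h -{2}(divff d1) -mulrDl subrKC mul1r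
     invr_eq0.
apply/esym/eqP; rewrite /k /h; field; rewrite d1 /=.
by rewrite subrK oner_neq0.
Qed.

(* The substitution is x = y / (y - 1). *)
Lemma jacobi_swapV chi psi :
  chi \is a linear_char -> psi \is a linear_char ->
  jacobi chi psi = mchar chi (-1) * jacobi chi (chi * psi)^-1.
Proof.
move=> chiL psiL; rewrite /jacobi mulr_sumr (bigD1 1) //= [RHS](bigD1 1) //=.
rewrite subrr !mchar0 !mulr0; congr (_ + _).
pose h (x : F) := x / (x - 1).
have hK x : x != 1 -> h (h x) = x.
  move=> x1; have d1 : x - 1 != 0 by rewrite subr_eq0.
  rewrite /h; field; rewrite d1 /=.
  by rewrite mulN1r subKr oner_neq0.
rewrite [RHS](reindex_onto h h) /= => [|x]; last exact: hK.
apply: eq_big => x.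
  have [->|x1] := eqVneq x 1.
    by rewrite /h subrr invr0 mulr0 mul0r [0 == 1]eq_sym oner_eq0 andbF.
  rewrite hK // eqxx andbT; have d1 : x - 1 != 0 by rewrite subr_eq0.
  by rewrite -subr_eq0 /h -{2}(divff d1) -mulrBl opprB addrC subrK mul1r invr_eq0.
move=> x1; have d1 : 1 - x != 0 by rewrite subr_eq0 eq_sym.
have d2 : x - 1 != 0 by rewrite subr_eq0.
rewrite mulrA -mcharM // mcharVc ?rpredM // mcharMc mulrA -mcharM //.
congr (mchar chi _ * mchar psi _).
  by rewrite /h; field; rewrite d2 /=;
  rewrite [x - 1]addrC addrK oppr_eq0 oner_neq0.
by rewrite /h; field; rewrite d2 /=;
  rewrite [x - 1]addrC addrK oppr_eq0 oner_neq0.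
Qed.

Variable theta : 'CF([set: F]%G).
Hypotheses (thetaL : theta \is a linear_char) (theta1 : theta != 1).
Local Notation g := (gauss theta).

Lemma addcharD x y : theta (x + y) = theta x * theta y.
Proof. by rewrite -FinRing.zmodMgE lin_charM ?inE. Qed.

Lemma addchar0 : theta 0 = 1.
Proof. exact: lin_char1. Qed.

Lemma sum_addchar : \sum_(x : F) theta x = 0.
Proof.
have [u theta_u] : exists u : F, theta u != 1.
  apply/existsP; apply: contraNT theta1 => /existsPn theta_u.
  apply/eqP/cfunP => u; rewrite cfun1E inE.
  by apply/eqP; rewrite -[_ == _]negbK theta_u.
apply/eqP; move: theta_u; apply: contraNT => S0; apply/eqP/(mulIf S0).
rewrite mul1r mulr_sumr [RHS](reindex_inj (addrI u)) /=.
by apply: eq_bigr => x _; rewrite addcharD.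
Qed.

Lemma sum_addchar_neq0 : \sum_(x : F | x != 0) theta x = -1.
Proof.
have /eqP := sum_addchar.
by rewrite (bigD1 0) //= addchar0 addrC addr_eq0 => /eqP.
Qed.

Lemma gauss1 : g 1 = -1.
Proof.
rewrite /gauss (bigD1 0) //= mchar0 mul0r add0r.
by rewrite -sum_addchar_neq0; apply: eq_bigr => x x0;
  rewrite mchar1_cfun x0 mul1r.
Qed.

(** The double sum is sorted by the sum [s] of the two arguments; the inner sum is a rescaled Jacobi
    sum for [s != 0] and a plain character sum for [s = 0]. *)
Lemma gaussM_sum chi psi :
  g chi * g psi
  = \sum_(s : F) theta s * \sum_(x : F) mchar chi x * mchar psi (s - x).
Proof.
rewrite /gauss mulr_suml.
under [RHS]eq_bigr do rewrite mulr_sumr.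
rewrite [RHS]exchange_big /=; apply: eq_bigr => x _.
rewrite mulr_sumr [RHS](reindex_inj (addrI x)) /=; apply: eq_bigr => y _.
by rewrite addcharD addrC addKr; ring.
Qed.

Lemma jacobi_scale chi psi s :
  chi \is a linear_char -> psi \is a linear_char -> s != 0 ->
  \sum_(x : F) mchar chi x * mchar psi (s - x)
  = mchar (chi * psi) s * jacobi chi psi.
Proof.
move=> chiL psiL s0; rewrite (reindex_inj (mulfI s0)) /= mulr_sumr.
apply: eq_bigr => x _; rewrite -{2}[s]mulr1 -mulrBr !mcharM // mcharMc.
by ring.
Qed.

Lemma jacobi_scale0 chi psi :
  chi \is a linear_char -> psi \is a linear_char ->
  \sum_(x : F) mchar chi x * mchar psi (0 - x)
  = mchar psi (-1) * \sum_(x : F) mchar (chi * psi) x.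
Proof.
move=> chiL psiL; rewrite mulr_sumr; apply: eq_bigr => x _.
by rewrite sub0r mcharN // mcharMc; ring.
Qed.

(** Nontriviality of [chi * psi] is what kills the contribution of [s = 0]. *)
Lemma gaussM chi psi :
    chi \is a linear_char -> psi \is a linear_char -> chi * psi != 1 ->
  g chi * g psi = g (chi * psi) * jacobi chi psi.
Proof.
move=> chiL psiL cp1; rewrite gaussM_sum [g (_ * _)]/gauss mulr_suml.
apply: eq_bigr => s _; have [->|s0] := eqVneq s 0.
  by rewrite jacobi_scale0 // sum_mchar ?rpredM // mchar0 !(mulr0, mul0r).
by rewrite jacobi_scale //; ring.
Qed.

(** Here [s = 0] contributes [chi(-1) (q - 1)], and the other [s] together contribute [chi(-1)], by
    [jacobiV] and [sum_addchar_neq0]. *)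
Lemma gaussMV chi : chi \is a linear_char -> chi != 1 ->
  g chi * g chi^-1 = mchar chi (-1) * #|F|%:R.
Proof.
move=> chiL chi1; have chiVL : chi^-1 \is a linear_char by rewrite rpredV.
have chiU := lin_char_unitr chiL.
rewrite gaussM_sum (bigD1 0) //= jacobi_scale0 // divrr // sum_mchar1 addchar0.
rewrite (eq_bigr (fun s => theta s * (- mchar chi (-1)))) => [|s s0]; last first.
  by rewrite jacobi_scale // divrr // mchar1_cfun s0 jacobiV // mul1r.
rewrite -mulr_suml mcharV_N1 // sum_addchar_neq0.
by ring.
Qed.

Lemma gauss_neq0 chi : chi \is a linear_char -> g chi != 0.
Proof.
move=> chiL; have [->|chi1] := eqVneq chi 1.
  by rewrite gauss1 oppr_eq0 oner_eq0.
have := gaussMV chiL chi1.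
apply: contra_eqN => /eqP->; rewrite mul0r eq_sym mulf_neq0 //.
  by rewrite mchar_neq0 // oppr_eq0 oner_eq0.
by rewrite pnatr_eq0 -lt0n; apply/card_gt0P; exists 0.
Qed.

End GaussJacobi.

(** * The quadratic character, sums over squares, and the sum over [chi] of products of Jacobi
    sums *)

Section QuadraticCharacter.

Variable F : finFieldType.
Hypothesis oddF : odd #|F|.
Implicit Types (chi psi A b : 'CF(unitg F)) (x y : F).

Lemma two_neq0 : (2 : F) != 0.
Proof.
(* By Lagrange in the additive group [#|F|] times [1] is [0]; if [2 = 0], oddness of [#|F|] would
   make it [1]. *)
apply/eqP => F2; have := expg_cardG (in_setT (1 : F)).
rewrite FinRing.zmodXgE cardsT -(odd_double_half #|F|) oddF.
rewrite -muln2 mulnC mulrnDr mulrnA F2.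
by rewrite mul0rn addr0 => /eqP; rewrite oner_eq0.
Qed.

Lemma eqr_opp_neq0 x : x != 0 -> (x == - x) = false.
Proof.
by move=> x0; rewrite -subr_eq0 opprK -mulr2n -mulr_natr mulf_eq0
  (negPf x0) (negPf two_neq0).
Qed.

Variable phi : 'CF(unitg F).
Hypotheses (phiL : phi \is a linear_char) (phi_order : #[phi]%CF = 2%N).

Lemma phi_sqr : phi ^+ 2 = 1.
Proof. by rewrite -phi_order exp_cforder. Qed.

Lemma phi_neq1 : phi != 1.
Proof. by rewrite -[phi]expr1 -dvdn_cforder phi_order. Qed.

Lemma phi_inv : phi^-1 = phi.
Proof.
by apply: (mulrI (lin_char_unitr phiL)); rewrite divrr ?lin_char_unitr //
  -expr2 phi_sqr.
Qed.

(** A linear character is determined by its value at a generator [u] of the cyclic group of units;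
    [phi u = 1] would make [phi] trivial. *)
Lemma unitg_generator :
  exists2 u : {unit F}, phi u = -1 &
    forall v : {unit F}, exists k, v = (u ^+ k)%g.
Proof.
have /cyclicP[u gen_u] := field_unit_group_cyclic (unitg F).
have powu (v : {unit F}) : exists k, v = (u ^+ k)%g.
  have : v \in <[u]>%g by rewrite -gen_u inE.
  by case/cyclePmin => k _ ->; exists k.
exists u => //.
have := congr1 (fun c : 'CF(unitg F) => c u) phi_sqr.
rewrite expr2 cfunE cfun1E inE -expr2 => /eqP; rewrite sqrf_eq1 => /orP[/eqP phiu|/eqP//].
case/eqP: phi_neq1; apply/cfunP => v; have [k ->] := powu v.
by rewrite lin_charX ?inE // phiu expr1n cfun1E inE.
Qed.

Lemma sqr_eq1_lin chi :
  chi \is a linear_char -> (chi ^+ 2 == 1) = (chi == 1) || (chi == phi).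
Proof.
move=> chiL; apply/eqP/orP => [chi2|[/eqP->|/eqP->]]; last 2 first.
- by rewrite expr1n.
- exact: phi_sqr.
have [u phiu powu] := unitg_generator.
have := congr1 (fun c : 'CF(unitg F) => c u) chi2.
rewrite expr2 cfunE cfun1E inE -expr2 => /eqP; rewrite sqrf_eq1.
case/orP => /eqP chiu; [left|right];
  apply/eqP/cfunP => v; have [k ->] := powu v;
  rewrite (lin_charX chiL) ?inE // chiu.
  by rewrite expr1n cfun1E inE.
by rewrite lin_charX ?inE // phiu.
Qed.

Lemma mchar_phiP x : x != 0 ->
  (exists2 y, x = y ^+ 2 & mchar phi x = 1)
  \/ ((forall y, y ^+ 2 != x) /\ mchar phi x = -1).
Proof.
case/unit_of_neq0=> v ->; have [u phiu powu] := unitg_generator.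
have [k ->] := powu v; rewrite mchar_unit lin_charX ?inE // phiu.
rewrite -signr_odd; case: (boolP (odd k)) => oddk; [right|left]; last first.
  exists (val (u ^+ k./2)%g) => //.
  by rewrite -FinRing.val_unitX -expgM muln2
    -[in LHS](odd_double_half k) (negPf oddk).
(* At a square, [phi] takes the value of [phi ^+ 2 = 1], which is [0] or [1] and never [-1]. *)
split=> // y; apply/eqP => /(congr1 (mchar phi)).
rewrite mchar_unit lin_charX ?inE // phiu -signr_odd oddk mcharX // -mcharXc phi_sqr.
rewrite mchar1_cfun; case: eqP => _ /eqP; last by rewrite -addr_eq0 -mulr2n pnatr_eq0.
by rewrite eq_sym oppr_eq0 oner_eq0.
Qed.

(** The factor [1 + phi(t)] counts the square roots of [t]; the convention [phi(0) = 0] gives the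
    single root of [0]. *)
Lemma sum_sqr (f : F -> algC) :
  \sum_(x : F) f (x ^+ 2) = \sum_(t : F) (1 + mchar phi t) * f t.
Proof.
rewrite (partition_big (fun x => x ^+ 2) predT) //=; apply: eq_bigr => t _.
rewrite (eq_bigr (fun=> f t)) => [|x /eqP-> //].
have [->|t0] := eqVneq t 0.
  rewrite mchar0 addr0 mul1r (eq_bigl (xpred1 0)) ?big_pred1_eq // => x.
  by rewrite expf_eq0.
have [[y t_y ->]|[nsq ->]] := mchar_phiP t0; last first.
  by rewrite subrr mul0r big1 // => x /eqP t_x; have := nsq x; rewrite t_x eqxx.
have y0 : y != 0 by apply: contraNneq t0 => y0; rewrite t_y y0 expr0n.
rewrite (bigD1 y) ?t_y ?eqxx //= (bigD1 (- y)) /= ?sqrrN ?eqxx 1?eq_sym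
  ?eqr_opp_neq0 //.
rewrite big1 => [|x]; last by rewrite eqf_sqr -andbA -negb_or; case: (_ || _).
by rewrite addr0 mulrDl mul1r.
Qed.

(** Evaluates the Kummer-type sum: since [A^2(x) = A(x^2)], the summand depends on [x ^+ 2] only. *)
Lemma sum_jacobi_sqr A psi : A \is a linear_char -> psi \is a linear_char ->
  \sum_(x : F) mchar (A ^+ 2) x * mchar psi (1 - x ^+ 2)
  = jacobi A psi + jacobi (phi * A) psi.
Proof.
move=> AL psiL; pose f t := mchar A t * mchar psi (1 - t).
rewrite (eq_bigr (fun x => f (x ^+ 2))) => [|x _]; last by rewrite /f mcharXc mcharX.
rewrite sum_sqr /jacobi -big_split; apply: eq_bigr => t _ /=.
by rewrite /f mcharMc; ring.
Qed.

(* Substituting x = (1 + u) / 2 turns 4 x (1 - x) into 1 - u^2. *)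
Lemma jacobi_diag chi : chi \is a linear_char -> chi != 1 ->
  mchar chi 4 * jacobi chi chi = jacobi phi chi.
Proof.
move=> chiL chi1; pose h x : F := (1 + x) / 2.
have h_inj : injective h by move=> x y /(mulIf (invr_neq0 two_neq0))/addrI.
rewrite /jacobi (reindex_inj h_inj) mulr_sumr.
rewrite (eq_bigr (fun x => mchar chi (1 - x ^+ 2))) => [|x _]; last first.
  rewrite -!mcharM //; congr (mchar chi _).
  by rewrite /h; field; exact: two_neq0.
rewrite (sum_sqr (fun t => mchar chi (1 - t))).
under eq_bigr do rewrite mulrDl mul1r.
(* The part without [phi] is a full sum of the nontrivial [chi] after [t -> 1 - t], hence zero. *)
rewrite big_split /= -[RHS]add0r; congr (_ + _).
by rewrite -[RHS](sum_mchar chiL chi1) [RHS](reindex_inj (inv_inj (subKr (1 : F)))).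
Qed.

(* The substitution is x = y / (1 + y), i.e. y = x / (1 - x). *)
Lemma jacobi_line chi psi : chi \is a linear_char -> psi \is a linear_char ->
  jacobi chi psi = \sum_(x : F) mchar chi x * mchar (chi * psi)^-1 (1 + x).
Proof.
(* This form of [x / (1 + x)] is a bijection of all of [F]: with [0^-1 = 0] it sends [-1] to [1],
   where both summands vanish. *)
move=> chiL psiL; pose h x : F := 1 - (1 + x)^-1.
have h_inj : injective h by move=> x y /addrI/oppr_inj/invr_inj/addrI.
rewrite /jacobi (reindex_inj h_inj); apply: eq_bigr => x _ /=.
have -> : 1 - h x = (1 + x)^-1 by rewrite /h subKr.
rewrite mcharVc ?rpredM // mcharMc mulrA -mcharM //.
have [->|x1] := eqVneq (1 + x) 0; first by rewrite invr0 !mchar0 !mulr0.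
congr (mchar chi _ * _); rewrite /h; field; exact: x1.
Qed.

(** Orthogonality detects [(x y)^2 = 1]; the two indicators never overlap because [1 != -1] in odd
    characteristic. *)
Lemma sum_irr_sqr x y :
  \sum_(chi <- irr (unitg F)) mchar (chi ^+ 2) x * mchar (chi ^+ 2) y
  = (#|F|%:R - 1) * ((x * y == 1)%:R + (x * y == -1)%:R).
Proof.
rewrite (eq_big_seq (fun chi => mchar chi ((x * y) ^+ 2))) => [|chi]; last first.
  rewrite mem_irr_unitg => chiL; rewrite !mcharXc mcharX // mcharM //.
  by rewrite exprMn.
rewrite sum_irr_mchar sqrf_eq1; congr (_ * _).
have [->|] := eqVneq (x * y) 1; first by rewrite eqr_opp_neq0 ?oner_neq0 // addr0.
by rewrite add0r.
Qed.

(** In each Jacobi sum the two characters multiply to [b], so [jacobi_line] gives both the weight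
    [b^-1(1 + x)], free of [chi]; the sum over [chi] then falls under [sum_irr_sqr]. *)
Lemma sum_irr_jacobiM A b (a := A ^+ 2) :
  A \is a linear_char -> b \is a linear_char ->
  \sum_(chi <- irr (unitg F))
     jacobi (b * chi ^+ 2) (chi ^+ 2)^-1
     * jacobi (a * chi ^+ 2) (a * b^-1 * chi ^+ 2)^-1
  = (#|F|%:R - 1)
    * (jacobi a (a^-1 * b ^+ 2) + (jacobi A b^-1 + jacobi (phi * A) b^-1)).
Proof.
move=> AL bL; have aL : a \is a linear_char by rewrite rpredX.
have [aU bU] := (lin_char_unitr aL, lin_char_unitr bL).
pose w (c : 'CF(unitg F)) (x : F) := mchar c x * mchar b^-1 (1 + x).
transitivity (\sum_(chi <- irr (unitg F)) \sum_(y : F) \sum_(x : F)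
    w a y * w b x * (mchar (chi ^+ 2) x * mchar (chi ^+ 2) y)).
  apply: eq_big_seq => chi; rewrite mem_irr_unitg => chiL.
  have c2L : chi ^+ 2 \is a linear_char by rewrite rpredX.
  have c2U := lin_char_unitr c2L.
  rewrite jacobi_line ?rpredM ?rpredV //.
  rewrite [X in _ * X]jacobi_line ?rpredV ?rpredM ?rpredV //.
  have -> : b * chi ^+ 2 / chi ^+ 2 = b by rewrite mulrK.
  have -> : a * chi ^+ 2 / (a / b * chi ^+ 2) = b.
    rewrite -[in X in X / _](divrK bU a) [_ * b * _]mulrAC [_ * b]mulrC mulrK //.
    by rewrite unitrMl // unitrMl ?unitrV.
  rewrite mulr_suml exchange_big; apply: eq_bigr => x _ /=.
  rewrite mulr_sumr; apply: eq_bigr => y _.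
  by rewrite /w !mcharMc; ring.
rewrite exchange_big /=.
have bVL : b^-1 \is a linear_char by rewrite rpredV.
rewrite -(sum_jacobi_sqr AL bVL) jacobi_line ?rpredM ?rpredV ?rpredX //.
rewrite -big_split mulr_sumr; apply: eq_bigr => y _ /=.
rewrite exchange_big /=.
under eq_bigr do rewrite -mulr_sumr sum_irr_sqr.
have [->|y0] := eqVneq y 0.
  rewrite !mchar0 !mul0r addr0 mulr0 big1 // => x _.
  by rewrite /w mchar0 !mul0r.
(* For fixed [y != 0] only [x = y^-1] and [x = - y^-1] survive; in characteristic not two they are
   distinct, but each indicator is summed separately. *)
transitivity ((#|F|%:R - 1) * w a y * (w b y^-1 + w b (- y^-1))).
  under eq_bigr do rewrite mulrDr mulrDr.
  rewrite big_split mulrDr /=; congr (_ + _).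
    rewrite (bigD1 y^-1) //= mulVf // eqxx big1 => [|x xy];
      first by rewrite addr0 mulr1 mulrC mulrA.
    suff -> : x * y == 1 = false by rewrite !mulr0.
    by apply: contraNF xy => /eqP xy; rewrite -[x](mulfK y0) xy mul1r.
  rewrite (bigD1 (- y^-1)) //= mulNr mulVf // eqxx big1 => [|x xy];
      first by rewrite addr0 mulr1 mulrC mulrA.
  suff -> : x * y == -1 = false by rewrite !mulr0.
  by apply: contraNF xy => /eqP xy; rewrite -[x](mulfK y0) xy mulN1r.
rewrite -mulrA; congr (_ * _).
(* The point [x = y^-1] must give [a(y) b^-1(1 + y)^2], the summand of [jacobi a (a^-1 * b ^+ 2)] on
   the line, and [x = - y^-1] must give [a(y) b^-1(1 - y^2)]. *)
have -> : (a * (a^-1 * b ^+ 2))^-1 = b^-1 * b^-1 by rewrite mulVKr // invrM.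
(* For [x != 0], [w b x] is [b^-1(1 + x^-1)]; the sign [c] is its own inverse. *)
have wb (c : F) : c ^+ 2 = 1 -> w b (c * y^-1) = mchar b^-1 (1 + c * y).
  move=> c2; have c0 : c != 0.
    by apply/eqP => c0; move/eqP: c2; rewrite c0 expr0n eq_sym oner_eq0.
  rewrite /w !mcharVc // -mcharM //; congr mchar.
  have -> : 1 + c * y = (1 + c / y) * (c * y).
    by rewrite mulrDl mul1r mulrACA -expr2 c2 mulVf // mul1r addrC.
  have cV : c^-1 = c by apply: (mulfI c0); rewrite divff // -expr2 c2.
  by rewrite invfM mulrC; congr (_ * _); rewrite invfM cV.
rewrite -[y^-1]mul1r -mulNr !wb ?sqrrN ?expr1n // mul1r mulN1r /w.
have -> : 1 - y ^+ 2 = (1 + y) * (1 - y) by ring.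
by rewrite mcharM ?rpredV // (mcharMc b^-1); ring.
Qed.

(** The quotient [R / A] squares to [1], so it is [1] or [phi]. *)
Lemma sum_irr_sqrt A (f : 'CF(unitg F) -> algC) : A \is a linear_char ->
  \sum_(R <- irr (unitg F) | R ^+ 2 == A ^+ 2) f R = f A + f (phi * A).
Proof.
move=> AL; have AU := lin_char_unitr AL.
rewrite -big_filter (perm_big [:: A; phi * A]); first by rewrite big_cons big_seq1.
apply: uniq_perm => [||R]; first by rewrite filter_uniq ?uniq_irr_unitg.
  rewrite /= inE andbT; apply/eqP => /(congr1 (fun c => c / A)) /esym/eqP.
  by rewrite mulrK // divrr // (negPf phi_neq1).
rewrite mem_filter mem_irr_unitg !inE andbC.
have [RL /=|RnL] := boolP (R \is a linear_char); last first.
  by apply/esym/norP; split; apply: contra RnL => /eqP-> //; rewrite rpredM.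
have RAL : R / A \is a linear_char by rewrite rpred_div.
have eqM c d : (c == d * A) = (c / A == d).
  by apply/eqP/eqP => [->|<-]; rewrite ?mulrK ?divrK.
have A2U : A ^+ 2 \is a GRing.unit by rewrite unitrX.
rewrite (_ : (R == A) = (R / A == 1)); last by rewrite -eqM mul1r.
rewrite [R == phi * A]eqM -sqr_eq1_lin // exprMn exprVn.
by apply/eqP/eqP => [->|/(congr1 (fun c => c * A ^+ 2))]; rewrite ?divrr // divrK ?mul1r.
Qed.

(** * The quadratic Hasse-Davenport relation and the reduction of the 4F4 to Jacobi sums *)

Variable theta : 'CF([set: F]%G).
Hypotheses (thetaL : theta \is a linear_char) (theta1 : theta != 1).
Local Notation g := (gauss theta).

Lemma four_neq0 : (4 : F) != 0.
Proof.
by rewrite (_ : 4 = 2 * 2 :> F) ?mulf_neq0 ?two_neq0 // -natrM.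
Qed.

(** When [chi ^+ 2 != 1], both sides are multiplied by [g chi]: [gaussM] on [g chi * g chi] produces
    [jacobi chi chi], [jacobi_diag] turns it into [jacobi phi chi], and [gaussM] is applied
    backwards. *)
Lemma hasse_davenport2 chi : chi \is a linear_char ->
  mchar chi 4 * (g chi * g (phi * chi)) = g (chi ^+ 2) * g phi.
Proof.
move=> chiL; have [chi2|chi2] := boolP (chi ^+ 2 == 1); last first.
  have chi1 : chi != 1 by apply: contraNneq chi2 => ->; rewrite expr1n.
  have phichi1 : phi * chi != 1.
    apply: contraNneq chi2 => /(congr1 (fun c => phi * c)).
    by rewrite mulrA -expr2 phi_sqr mul1r mulr1 => ->; rewrite phi_sqr.
  apply: (mulIf (gauss_neq0 thetaL theta1 chiL)).
  transitivity (mchar chi 4 * (g chi * g chi) * g (phi * chi)); first by ring.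
  rewrite gaussM // mulrCA jacobi_diag // -mulrA [_ * g (_ * _)]mulrC -gaussM //.
  by rewrite mulrA.
(* For [chi = 1] or [chi = phi] both sides are [g 1 * g phi], since [phi(4) = phi(2)^2 = 1]. *)
move: chi2; rewrite sqr_eq1_lin // => /orP[/eqP->|/eqP->].
  by rewrite mchar1_cfun four_neq0 mul1r mulr1 expr1n.
rewrite -expr2 phi_sqr (_ : 4 = 2 ^+ 2 :> F); last by rewrite -natrX.
by rewrite mcharX // -mcharXc phi_sqr mchar1_cfun two_neq0 mul1r mulrC.
Qed.

(** Quotient of the Hasse-Davenport relations at [A * chi] and at [A]: [g phi] and [A(4)] cancel. *)
Lemma gauss_ratio A chi : A \is a linear_char -> chi \is a linear_char ->
  g (A * chi) / g A * (g (phi * (A * chi)) / g (phi * A))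
  = g (A ^+ 2 * chi ^+ 2) / g (A ^+ 2) / mchar chi 4.
Proof.
move=> AL chiL; have AcL : A * chi \is a linear_char by rewrite rpredM.
have HA := hasse_davenport2 AL; have := hasse_davenport2 AcL.
have gN0 psi : psi \is a linear_char -> g psi != 0 by exact: gauss_neq0.
rewrite mcharMc exprMn => HAc.
have [A4 c4] := (mchar_neq0 AL four_neq0, mchar_neq0 chiL four_neq0).
have [gA gpA] : g A != 0 /\ g (phi * A) != 0 by rewrite !gN0 ?rpredM.
have gA2 : g (A ^+ 2) != 0 by rewrite gN0 ?rpredX.
rewrite mulf_div -[RHS]mulrA -invfM; apply/eqP.
rewrite eqr_div ?mulf_neq0 //; apply/eqP.
apply: (mulIf (gN0 _ phiL)); apply: (mulfI A4).
transitivity (mchar A 4 * mchar chi 4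
    * (g (A * chi) * g (phi * (A * chi))) * (g (A ^+ 2) * g phi)).
  by ring.
by rewrite HAc -HA; ring.
Qed.

(** Used with [chi] a square root of [a] and [psi = b]. Passing to [jacobi chi (chi^-1 * psi)] makes
    the product of characters [psi], so [gaussM] applies even when [chi = psi]; the reflection
    formula at [chi] and [chi ^+ 2] then gives the quotient. *)
Lemma gauss_jacobiV chi psi : chi \is a linear_char -> psi \is a linear_char ->
    chi ^+ 2 != 1 -> psi != 1 ->
  g psi * jacobi chi psi^-1 / g (chi ^+ 2)
  = g (chi ^+ 2)^-1 * g (chi^-1 * psi) / g chi^-1.
Proof.
move=> chiL psiL chi2 psi1.
have gN0 c : c \is a linear_char -> g c != 0 by exact: gauss_neq0.
have [chiU psiU] := (lin_char_unitr chiL, lin_char_unitr psiL).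
have chi1 : chi != 1 by apply: contraNneq chi2 => ->; rewrite expr1n.
have inv : (chi * psi^-1)^-1 = chi^-1 * psi by rewrite invrM ?unitrV // invrK mulrC.
have chiinv : chi * (chi^-1 * psi) = psi by rewrite mulVKr.
have E : g psi * jacobi chi psi^-1 = mchar chi (-1) * (g chi * g (chi^-1 * psi)).
  rewrite jacobi_swapV ?rpredV // inv gaussM ?rpredM ?rpredV ?chiinv //.
  by rewrite mulrCA.
have q2 : g (chi ^+ 2) * g (chi ^+ 2)^-1 = #|F|%:R.
  by rewrite gaussMV ?rpredX // mcharXc mcharN1_sqr // mul1r.
have q1 := gaussMV thetaL theta1 chiL chi1.
apply/eqP; rewrite eqr_div ?gN0 ?rpredV ?rpredX //; apply/eqP; rewrite E.
transitivity (mchar chi (-1) * (g chi * g chi^-1) * g (chi^-1 * psi)); first by ring.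
rewrite q1 mulrA -expr2 mcharN1_sqr // -q2; ring.
Qed.

(** The eight Gauss quotients form four pairs differing by [phi], each collapsed by [gauss_ratio].
    The upper pairs carry [chi(4)^-1] and the lower ones [chi(4)], so these factors cancel. *)
Lemma hyperF_sum_jacobi A B (a := A ^+ 2) (b := B ^+ 2) :
    A \is a linear_char -> B \is a linear_char -> b != 1 ->
  hyperF theta [tuple A; phi * A; B; phi * B]
               [tuple 1; phi; A * B^-1; phi * A * B^-1] 1
  = g b / (g a * g (a^-1 * b))
    * ((#|F|%:R - 1)^-1 * \sum_(chi <- irr (unitg F))
         jacobi (b * chi ^+ 2) (chi ^+ 2)^-1
         * jacobi (a * chi ^+ 2) (a * b^-1 * chi ^+ 2)^-1).
Proof.
move=> AL BL b1.
have gN0 c : c \is a linear_char -> g c != 0 by exact: gauss_neq0.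
have [AU BU] := (lin_char_unitr AL, lin_char_unitr BL).
rewrite /hyperF mulNr mul1r mulNr -mulrN mulrCA; congr (_ * _).
rewrite -sumrN mulr_sumr; apply: eq_big_seq => chi; rewrite mem_irr_unitg => chiL.
have chiU := lin_char_unitr chiL.
rewrite mchar1 // mulr1 (exprM _ 2 2) mcharN1_sqr // expr1n mulr1.
rewrite !big_ord_recl big_ord0 !(tnth_nth 0) /= !mulr1 mul1r.
have cVL : chi^-1 \is a linear_char by rewrite rpredV.
have ABL : A / B \is a linear_char by rewrite rpred_div.
have ABVL : (A / B)^-1 \is a linear_char by rewrite rpredV.
have phiV c : c \is a linear_char -> (phi * c)^-1 = phi * c^-1.
  by move=> cL; rewrite invrM ?lin_char_unitr // phi_inv mulrC.
have ABc : (A / B * chi)^-1 = (A / B)^-1 * chi^-1.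
  by rewrite invrM ?lin_char_unitr // mulrC.
(* The lower pair formed by the trivial character and [phi]; lower parameters occur inverted, hence
   [chi^-1]. *)
have r1 := gauss_ratio (cfun1_lin_char _) cVL.
rewrite expr1n !mul1r mulr1 in r1.
have := (gauss_ratio AL chiL, gauss_ratio BL chiL, r1, gauss_ratio ABVL cVL).
rewrite -(mulrA phi A chi) -(mulrA phi B chi) -(mulrA phi A)
  -(mulrA phi (A / B) chi).
rewrite !phiV ?rpredM ?rpredV // phi_inv invr1 ABc => -[[[rA rB] {}r1] rAB].
transitivity (- ((g (A * chi) / g A * (g (phi * (A * chi)) / g (phi * A)))
    * (g (B * chi) / g B * (g (phi * (B * chi)) / g (phi * B)))
    * (g chi^-1 / g 1 * (g (phi * chi^-1) / g phi))
    * (g ((A / B)^-1 * chi^-1) / g (A / B)^-1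
       * (g (phi * ((A / B)^-1 * chi^-1)) / g (phi * (A / B)^-1))))).
  by rewrite -!mulrA; congr (- _); ring.
have aL : a \is a linear_char by rewrite rpredX.
have bL : b \is a linear_char by rewrite rpredX.
have [aU bU] := (lin_char_unitr aL, lin_char_unitr bL).
have psiL : chi ^+ 2 \is a linear_char by rewrite rpredX.
have abL : a / b \is a linear_char by rewrite rpred_div.
have abpsiL : a / b * chi ^+ 2 \is a linear_char by rewrite rpredM.
have [abU psiU] := (lin_char_unitr abL, lin_char_unitr psiL).
rewrite rA rB r1 rAB -/a -/b.
have -> : (A / B)^-1 ^+ 2 * chi^-1 ^+ 2 = (a / b * chi ^+ 2)^-1.
  by rewrite -exprMn -ABc exprVn !exprMn exprVn.
have -> : (A / B)^-1 ^+ 2 = a^-1 * b.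
  by rewrite exprVn exprMn exprVn invrM ?unitrV // invrK mulrC.
have c4 : mchar chi 4 != 0 by rewrite mchar_neq0 ?four_neq0.
(* The value [g 1 = -1] absorbs the sign in front of the hypergeometric sum. *)
rewrite exprVn (mcharVc _ chiL) (mcharV _ chiL) (gauss1 thetaL theta1).
(* Both pairings have product [b], nontrivial and independent of [chi], so no character is
   exceptional for [gaussM]. *)
have E1 : g (b * chi ^+ 2) * g (chi ^+ 2)^-1
    = g b * jacobi (b * chi ^+ 2) (chi ^+ 2)^-1.
  by rewrite gaussM ?mulrK ?rpredM ?rpredV.
have abpsiK : a * chi ^+ 2 / (a / b * chi ^+ 2) = b.
  by rewrite -[in X in X / _](divrK bU a) [_ * b * _]mulrAC [_ * b]mulrC
    mulrK ?lin_char_unitr.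
have E2 : g (a * chi ^+ 2) * g (a / b * chi ^+ 2)^-1
    = g b * jacobi (a * chi ^+ 2) (a / b * chi ^+ 2)^-1.
  by rewrite gaussM ?abpsiK ?rpredM ?rpredV.
have [ga [gb gab]] : g a != 0 /\ g b != 0 /\ g (a^-1 * b) != 0.
  by rewrite !gN0 ?rpredM ?rpredV.
transitivity ((g (b * chi ^+ 2) * g (chi ^+ 2)^-1)
  * (g (a * chi ^+ 2) * g (a / b * chi ^+ 2)^-1) / (g a * g b * g (a^-1 * b))).
  by field; rewrite ga gb gab c4.
by rewrite E1 E2; field; rewrite ga gb gab.
Qed.

End QuadraticCharacter.

Theorem corollary5p1 (F : finFieldType) (hF : odd #|F|)
  (theta : 'CF([set: F]%G)) (htheta : theta \is a linear_char)
  (htheta1 : theta != 1)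
  (phi : 'CF(unitg F)) (hphi : phi \is a linear_char) (hphi2 : #[phi]%CF = 2%N)
  (A B : 'CF(unitg F)) (hA : A \is a linear_char) (hB : B \is a linear_char)
  (hA2 : A ^+ 2 != 1) (hB4 : B ^+ 4 != 1) :
  hyperF theta [tuple A; phi * A; B; phi * B]
               [tuple 1; phi; A * B^-1; phi * A * B^-1] 1
  = gauss theta (B ^+ 2) * gauss theta (A^-1 ^+ 2 * B ^+ 4)
      / (gauss theta (A^-1 ^+ 2 * B ^+ 2) * gauss theta (B ^+ 4))
    + \sum_(R <- irr (unitg F) | R ^+ 2 == A ^+ 2)
        gauss theta (A^-1 ^+ 2) * gauss theta (R^-1 * B ^+ 2)
          / (gauss theta R^-1 * gauss theta (A^-1 ^+ 2 * B ^+ 2)).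
Proof.
have b1 : B ^+ 2 != 1 by apply: contraNneq hB4 => b1; rewrite (exprM _ 2 2) b1 expr1n.
have aL : A ^+ 2 \is a linear_char by rewrite rpredX.
have bL : B ^+ 2 \is a linear_char by rewrite rpredX.
have pAL : phi * A \is a linear_char by rewrite rpredM.
have pA2 : (phi * A) ^+ 2 = A ^+ 2 by rewrite exprMn (phi_sqr hphi2) mul1r.
have gN0 c : c \is a linear_char -> gauss theta c != 0 by exact: gauss_neq0.
rewrite (sum_irr_sqrt hphi hphi2 _ hA).
rewrite (hyperF_sum_jacobi hF hphi hphi2) // (sum_irr_jacobiM hF hphi hphi2) //.
rewrite mulKf ?card_field_sub1_neq0 // !exprVn (exprM B 2 2).
(* The two square roots [A] and [phi * A] of [A ^+ 2] yield the two terms of the sum over [R]. *)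
move: (gauss_jacobiV htheta htheta1 hA bL hA2 b1).
have := gauss_jacobiV htheta htheta1 pAL bL; rewrite pA2 => /(_ hA2 b1).
set a := A ^+ 2; set b := B ^+ 2 => JpA JA.
have aU := lin_char_unitr aL.
have ab : a * (a^-1 * b ^+ 2) = b ^+ 2 by rewrite mulVKr.
have aVL : a^-1 \is a linear_char by rewrite rpredV.
have b2L : b ^+ 2 \is a linear_char by rewrite rpredX.
(* The product of these characters is [B ^+ 4], nontrivial by [hB4]. *)
have Ja : gauss theta a * gauss theta (a^-1 * b ^+ 2)
    = gauss theta (b ^+ 2) * jacobi a (a^-1 * b ^+ 2).
  by rewrite gaussM ?rpredM // ab // -exprM.
have [ga [gb2 gab]] : gauss theta a != 0 /\ gauss theta (b ^+ 2) != 0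
    /\ gauss theta (a^-1 * b) != 0 by rewrite !gN0 ?rpredM.
transitivity (gauss theta b * (gauss theta (b ^+ 2) * jacobi a (a^-1 * b ^+ 2))
      / (gauss theta a * gauss theta (a^-1 * b) * gauss theta (b ^+ 2))
    + (gauss theta b * jacobi A b^-1 / gauss theta a
       + gauss theta b * jacobi (phi * A) b^-1 / gauss theta a)
      / gauss theta (a^-1 * b)); first by field; rewrite ga gb2 gab.
have [gA gpA] : gauss theta A^-1 != 0 /\ gauss theta (phi * A)^-1 != 0.
  by rewrite !gN0 ?rpredV.
rewrite -Ja JA JpA; field; rewrite ga gb2 gab gA gpA //.
Qed.
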